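(* Let $f:\mathbf{R}^N\to\mathbf{R}$ be a differentiable convex function with block Lipschitz gradient, let $\Omega:\mathbf{R}^N\to\mathbf{R}\cup\{+\infty\}$ be a proper closed convex block separable function, let $F=f+\Omega$, and assume that $F$ attains its minimum value $F^*>-\infty$ over $\mathbf{R}^N$. Let $\hat S$ be a proper uniform sampling, $\beta>0$, $w\in\mathbf{R}^n_{++}$, assume that $(f,\hat S)\sim ESO(\beta,w)$, and let $\alpha=\mathbf{E}[|\hat S|]/n$. Let $\mu_f(w)\ge0$ and $\mu_\Omega(w)\ge0$ be (strong) convexity parameters of $f$ and $\Omega$ with respect to $\|\cdot\|_w$ and assume $\mu_f(w)+\mu_\Omega(w)>0$. Let $x_0\in\operatorname{dom}F$, $0<\rho<1$, $0<\epsilon<F(x_0)-F^*$, and let $K$ be an integer with $$K\ge\frac1\alpha\,\frac{\beta+\mu_\Omega(w)}{\mu_f(w)+\mu_\Omega(w)}\log\left(\frac{F(x_0)-F^*}{\epsilon\rho}\right).$$ If $\{x_k\}$ are the random points generated, starting from $x_0$, by PCDM1 or by PCDM2 (run with parameters $\beta,w$ and sampling $\hat S$), then $\mathbf{P}(F(x_K)-F^*\le\epsilon)\ge1-\rho$.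
   Context: Blocks: $[n]=\{1,\dots,n\}$; $N=N_1+\dots+N_n$ with $N_i\ge1$; $U=[U_1,\dots,U_n]$ is a column permutation of the $N\times N$ identity matrix, with $U_i$ of size $N\times N_i$. For $x\in\mathbf{R}^N$, the $i$-th block is $x^{(i)}=U_i^Tx\in\mathbf{R}^{N_i}$, and for $S\subseteq[n]$, $x_{[S]}=\sum_{i\in S}U_ix^{(i)}$. $\langle\cdot,\cdot\rangle$ is the Euclidean inner product. For fixed symmetric positive definite matrices $B_i\in\mathbf{R}^{N_i\times N_i}$, $\|t\|_{(i)}=\langle B_it,t\rangle^{1/2}$ and $\|t\|_{(i)}^*=\langle B_i^{-1}t,t\rangle^{1/2}$. For $w\in\mathbf{R}^n_{++}$ (positive entries), $\|x\|_w=(\sum_{i=1}^nw_i\|x^{(i)}\|_{(i)}^2)^{1/2}$. Block Lipschitz gradient: there are constants $L_1,\dots,L_n>0$ with $\|U_i^T\nabla f(x+U_it)-U_i^T\nabla f(x)\|_{(i)}^*\le L_i\|t\|_{(i)}$ for all $x\in\mathbf{R}^N$, $i\in[n]$, $t\in\mathbf{R}^{N_i}$. Block separable: $\Omega(x)=\sum_{i=1}^n\Omega_i(x^{(i)})$ with $\Omega_i:\mathbf{R}^{N_i}\to\mathbf{R}\cup\{+\infty\}$ closed and convex. $\operatorname{dom}F=\{x:F(x)<+\infty\}$. (Strong) convexity parameter: $\phi:\mathbf{R}^N\to\mathbf{R}\cup\{+\infty\}$ has convexity parameter $\mu_\phi(w)\ge0$ with respect to $\|\cdot\|_w$ if $\phi(y)\ge\phi(x)+\langle\phi'(x),y-x\rangle+\frac{\mu_\phi(w)}2\|y-x\|_w^2$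 for all $x,y\in\operatorname{dom}\phi$ and any subgradient $\phi'(x)$ of $\phi$ at $x$; equivalently $\phi(\lambda x+(1-\lambda)y)\le\lambda\phi(x)+(1-\lambda)\phi(y)-\frac{\mu_\phi(w)\lambda(1-\lambda)}2\|x-y\|_w^2$ for all $x,y\in\operatorname{dom}\phi$, $\lambda\in[0,1]$. The value $0$ corresponds to plain convexity. A sampling $\hat S$ is a random subset of $[n]$. It is proper if $\mathbf{P}(i\in\hat S)>0$ for all $i$, and uniform if $\mathbf{P}(i\in\hat S)$ does not depend on $i$. ESO: for $\beta>0$, $w\in\mathbf{R}^n_{++}$ and a proper uniform sampling $\hat S$, $(f,\hat S)\sim ESO(\beta,w)$ means that for all $x,h\in\mathbf{R}^N$, $$\mathbf{E}[f(x+h_{[\hat S]})]\le f(x)+\tfrac{\mathbf{E}[|\hat S|]}{n}\left(\langle\nabla f(x),h\rangle+\tfrac\beta2\|h\|_w^2\right).$$ Update: $h(x)=\arg\min_{h\in\mathbf{R}^N}\{f(x)+\langle\nabla f(x),h\rangle+\frac\beta2\|h\|_w^2+\Omega(x+h)\}$. Algorithms: let $S_0,S_1,\dots$ be i.i.d. random sets distributed as $\hat S$. PCDM1: $x_{k+1}=x_k+(h(x_k))_{[S_k]}$. PCDM2: $x_{k+1}=x_k+(h(x_k))_{[S_k]}$ if $F(x_k+(h(x_k))_{[S_k]})\le F(x_k)$, and $x_{k+1}=x_k$ otherwise. *)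

(* Defs.v *)
From HB Require Import structures.
From mathcomp Require Export all_boot all_order all_algebra.
From mathcomp Require Export perm.
From mathcomp Require Export all_classical all_reals all_analysis.

Set Implicit Arguments.
Unset Strict Implicit.
Unset Printing Implicit Defensive.

Import Order.TTheory GRing.Theory Num.Theory.
Import numFieldNormedType.Exports.

Local Open Scope classical_set_scope.
Local Open Scope ring_scope.

Definition dot (R : realType) (m : nat) (x y : 'cV[R]_m) : R :=
  \sum_(j < m) x j 0 * y j 0.

Definition gradient (R : realType) (m : nat) (f : 'cV[R]_m -> R)
    (x : 'cV[R]_m) : 'cV[R]_m :=
  \col_(j < m) 'D_(delta_mx j 0) f x.

Definition sym_posdef (R : realType) (m : nat) (B : 'M[R]_m) : Prop :=
  B^T = B /\ forall t : 'cV[R]_m, t != 0 -> 0 < dot (B *m t) t.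

(** Functions R^m -> R u {+oo} are functions into [\bar R] avoiding [-oo]. *)

Definition avoids_ninfty (R : realType) (m : nat)
    (phi : 'cV[R]_m -> \bar R) : Prop :=
  forall x, phi x != -oo%E.

Definition edom (R : realType) (m : nat) (phi : 'cV[R]_m -> \bar R) :
    set 'cV[R]_m :=
  [set x | (phi x < +oo)%E].

Definition proper_fun (R : realType) (m : nat)
    (phi : 'cV[R]_m -> \bar R) : Prop :=
  avoids_ninfty phi /\ edom phi !=set0.

Definition closed_fun (R : realType) (m : nat)
    (phi : 'cV[R]_m -> \bar R) : Prop :=
  closed [set p : 'cV[R]_m * R | (phi p.1 <= p.2%:E)%E].

(* In [\bar R], 0 * +oo = 0, so that the cases l = 0 and l = 1 are trivial. *)
Definition convex_efun (R : realType) (m : nat)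
    (phi : 'cV[R]_m -> \bar R) : Prop :=
  forall (x y : 'cV[R]_m) (l : R), 0 <= l -> l <= 1 ->
    (phi (l *: x + (1 - l) *: y)%R <= l%:E * phi x + (1 - l)%:E * phi y)%E.

Definition subgradient (R : realType) (m : nat) (phi : 'cV[R]_m -> \bar R)
    (x g : 'cV[R]_m) : Prop :=
  forall y, (phi x + (dot g (y - x))%:E <= phi y)%E.

Definition convexity_parameter (R : realType) (m : nat)
    (norm : 'cV[R]_m -> R) (phi : 'cV[R]_m -> \bar R) (mu : R) : Prop :=
  0 <= mu /\
  forall x y g, edom phi x -> edom phi y -> subgradient phi x g ->
    (phi x + (dot g (y - x) + mu / 2 * norm (y - x) ^+ 2)%:E <= phi y)%E.

Definition min_value (R : realType) (m : nat) (phi : 'cV[R]_m -> \bar R)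
    (v : R) : Prop :=
  (exists x, phi x = v%:E) /\ forall x, (v%:E <= phi x)%E.

(* Some global minimizer of [phi], and [0] if there is none. *)
Definition argmin (R : realType) (m : nat) (phi : 'cV[R]_m -> \bar R) :
    'cV[R]_m :=
  xget 0 [set x | forall y, (phi x <= phi y)%E].

(** Blocks: R^N with N = N_1 + ... + N_n, and U = [U_1, ..., U_n] where U_i is
    [submxrow U i]. *)

Definition column_permutation_of_1 (R : realType) (m : nat) (U : 'M[R]_m) :
    Prop :=
  exists s : 'S_m, U = col_perm s 1%:M.

Definition block (R : realType) (n : nat) (N_ : 'I_n -> nat)
    (U : 'M[R]_(\sum_i N_ i)) (i : 'I_n) (x : 'cV[R]_(\sum_i N_ i)) :
    'cV[R]_(N_ i) :=
  (submxrow U i)^T *m x.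

Definition restrict_blocks (R : realType) (n : nat) (N_ : 'I_n -> nat)
    (U : 'M[R]_(\sum_i N_ i)) (x : 'cV[R]_(\sum_i N_ i)) (S : {set 'I_n}) :
    'cV[R]_(\sum_i N_ i) :=
  \sum_(i in S) submxrow U i *m block U i x.

Definition bnorm (R : realType) (m : nat) (B : 'M[R]_m) (t : 'cV[R]_m) : R :=
  Num.sqrt (dot (B *m t) t).

Definition bnorm_dual (R : realType) (m : nat) (B : 'M[R]_m) (t : 'cV[R]_m) :
    R :=
  Num.sqrt (dot (invmx B *m t) t).

Definition wnorm (R : realType) (n : nat) (N_ : 'I_n -> nat)
    (U : 'M[R]_(\sum_i N_ i)) (B : forall i, 'M[R]_(N_ i)) (w : 'I_n -> R)
    (x : 'cV[R]_(\sum_i N_ i)) : R :=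
  Num.sqrt (\sum_(i < n) w i * bnorm (B i) (block U i x) ^+ 2).

Definition block_lipschitz_gradient (R : realType) (n : nat) (N_ : 'I_n -> nat)
    (U : 'M[R]_(\sum_i N_ i)) (B : forall i, 'M[R]_(N_ i))
    (f : 'cV[R]_(\sum_i N_ i) -> R) : Prop :=
  exists L : 'I_n -> R, (forall i, 0 < L i) /\
    forall (x : 'cV[R]_(\sum_i N_ i)) (i : 'I_n) (t : 'cV[R]_(N_ i)),
      bnorm_dual (B i) (block U i (gradient f (x + submxrow U i *m t))
                        - block U i (gradient f x))
      <= L i * bnorm (B i) t.

Definition block_separable (R : realType) (n : nat) (N_ : 'I_n -> nat)
    (U : 'M[R]_(\sum_i N_ i)) (Omega : 'cV[R]_(\sum_i N_ i) -> \bar R) : Prop :=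
  exists Omega_ : forall i, 'cV[R]_(N_ i) -> \bar R,
    (forall i, [/\ avoids_ninfty (Omega_ i), closed_fun (Omega_ i)
                 & convex_efun (Omega_ i)]) /\
    forall x, Omega x = (\sum_(i < n) Omega_ i (block U i x))%E.

Definition random_subset (d : measure_display) (T : measurableType d)
    (n : nat) (S : T -> {set 'I_n}) : Prop :=
  forall A : {set 'I_n}, measurable [set t | S t = A].

Definition proper_sampling (R : realType) (d : measure_display)
    (T : measurableType d) (P : probability T R) (n : nat)
    (S : T -> {set 'I_n}) : Prop :=
  forall i : 'I_n, (0 < P [set t | i \in S t])%E.

Definition uniform_sampling (R : realType) (d : measure_display)
    (T : measurableType d) (P : probability T R) (n : nat)
    (S : T -> {set 'I_n}) : Prop :=
  forall i j : 'I_n, P [set t | i \in S t] = P [set t | j \in S t].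

(* E[|S|] / n *)
Definition sampling_rate (R : realType) (d : measure_display)
    (T : measurableType d) (P : probability T R) (n : nat)
    (S : T -> {set 'I_n}) : R :=
  fine ('E_P[fun t => #|S t|%:R])%E / n%:R.

Definition ESO (R : realType) (n : nat) (N_ : 'I_n -> nat)
    (U : 'M[R]_(\sum_i N_ i)) (B : forall i, 'M[R]_(N_ i))
    (d : measure_display) (T : measurableType d) (P : probability T R)
    (f : 'cV[R]_(\sum_i N_ i) -> R) (S : T -> {set 'I_n})
    (beta : R) (w : 'I_n -> R) : Prop :=
  forall x h : 'cV[R]_(\sum_i N_ i),
    ('E_P[fun t => f (x + restrict_blocks U h (S t))%R]
     <= (f x + sampling_rate P S
               * (dot (gradient f x) h
                  + beta / 2 * wnorm U B w h ^+ 2))%:E)%E.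

Definition same_law (R : realType) (n : nat)
    (d : measure_display) (T : measurableType d) (P : probability T R)
    (S : T -> {set 'I_n})
    (d' : measure_display) (T' : measurableType d') (P' : probability T' R)
    (S' : T' -> {set 'I_n}) : Prop :=
  forall A : {set 'I_n}, P [set t | S t = A] = P' [set t | S' t = A].

Definition mutually_independent (R : realType) (n : nat)
    (d : measure_display) (T : measurableType d) (P : probability T R)
    (S : nat -> T -> {set 'I_n}) : Prop :=
  forall (J : seq nat) (A : nat -> {set {set 'I_n}}), uniq J ->
    P [set t | forall k, k \in J -> S k t \in A k]
    = (\prod_(k <- J) P [set t | S k t \in A k])%E.

(* In PCDM1 and PCDM2, [S] is one realization of the sequence of random sets. *)

Definition objective (R : realType) (m : nat) (f : 'cV[R]_m -> R)
    (Omega : 'cV[R]_m -> \bar R) (x : 'cV[R]_m) : \bar R :=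
  ((f x)%:E + Omega x)%E.

Definition update (R : realType) (n : nat) (N_ : 'I_n -> nat)
    (U : 'M[R]_(\sum_i N_ i)) (B : forall i, 'M[R]_(N_ i))
    (f : 'cV[R]_(\sum_i N_ i) -> R) (Omega : 'cV[R]_(\sum_i N_ i) -> \bar R)
    (beta : R) (w : 'I_n -> R) (x : 'cV[R]_(\sum_i N_ i)) :
    'cV[R]_(\sum_i N_ i) :=
  argmin (fun h : 'cV[R]_(\sum_i N_ i) =>
    ((f x + dot (gradient f x) h + beta / 2 * wnorm U B w h ^+ 2)%:E
     + Omega (x + h)%R)%E).

Fixpoint PCDM1 (R : realType) (n : nat) (N_ : 'I_n -> nat)
    (U : 'M[R]_(\sum_i N_ i)) (B : forall i, 'M[R]_(N_ i))
    (f : 'cV[R]_(\sum_i N_ i) -> R) (Omega : 'cV[R]_(\sum_i N_ i) -> \bar R)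
    (beta : R) (w : 'I_n -> R) (x0 : 'cV[R]_(\sum_i N_ i))
    (S : nat -> {set 'I_n}) (k : nat) : 'cV[R]_(\sum_i N_ i) :=
  if k is k'.+1 then
    let x := PCDM1 U B f Omega beta w x0 S k' in
    x + restrict_blocks U (update U B f Omega beta w x) (S k')
  else x0.

Fixpoint PCDM2 (R : realType) (n : nat) (N_ : 'I_n -> nat)
    (U : 'M[R]_(\sum_i N_ i)) (B : forall i, 'M[R]_(N_ i))
    (f : 'cV[R]_(\sum_i N_ i) -> R) (Omega : 'cV[R]_(\sum_i N_ i) -> \bar R)
    (beta : R) (w : 'I_n -> R) (x0 : 'cV[R]_(\sum_i N_ i))
    (S : nat -> {set 'I_n}) (k : nat) : 'cV[R]_(\sum_i N_ i) :=
  if k is k'.+1 then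
    let x := PCDM2 U B f Omega beta w x0 S k' in
    let y := x + restrict_blocks U (update U B f Omega beta w x) (S k') in
    if (objective f Omega y <= objective f Omega x)%E then y else x
  else x0.

(* Main.v *)
Require Import Defs.
From mathcomp Require Import ring lra.

Set Implicit Arguments.
Unset Strict Implicit.
Unset Printing Implicit Defensive.

Import Order.TTheory GRing.Theory Num.Theory.
Import numFieldNormedType.Exports.
Local Open Scope classical_set_scope.
Local Open Scope ring_scope.

(** The expected gap [F(x_k) - Fstar] contracts at each step by the factor
    [1 - alpha gamma], where [gamma = (mu_f + mu_Omega) / (beta + mu_Omega)];
    iterating this over i.i.d. samples and applying Markov's inequality gives
    the bound. For one step, ESO and block separability yield
    [E F(x + h_S) <= (1 - alpha) F(x) + alpha H(x, h)], where [H(x, h)] is the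
    minimal value of the model defining the update [h]. The optimality condition
    for [h] exhibits a subgradient of [Omega] at [x + h]; combining strong
    convexity there with strong convexity of [f] at [x] gives
    [H(x, h) - Fstar <= (1 - gamma) (F(x) - Fstar)]. That [gamma <= 1], that is
    [mu_f <= beta], comes from comparing ESO with strong convexity of [f].
    The update exists because the model is strongly convex, closed, and bounded
    below: [- grad f] at a minimizer of [F] is a subgradient of [Omega]. *)

(** * Bilinearity of the Euclidean inner product *)

Section Dot.
Variables (R : realType).
Implicit Types m p : nat.

Lemma dotE m (x y : 'cV[R]_m) : dot x y = (x^T *m y) 0 0.
Proof. by rewrite mxE; apply: eq_bigr => j _; rewrite mxE. Qed.

Lemma dotC m (x y : 'cV[R]_m) : dot x y = dot y x.
Proof. by apply: eq_bigr => j _; rewrite mulrC. Qed.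

Lemma dotDr m (x y z : 'cV[R]_m) : dot x (y + z) = dot x y + dot x z.
Proof. by rewrite !dotE mulmxDr mxE. Qed.

Lemma dotDl m (x y z : 'cV[R]_m) : dot (y + z) x = dot y x + dot z x.
Proof. by rewrite dotC dotDr !(dotC x). Qed.

Lemma dotZr m a (x y : 'cV[R]_m) : dot x (a *: y) = a * dot x y.
Proof. by rewrite !dotE -scalemxAr mxE. Qed.

Lemma dotZl m a (x y : 'cV[R]_m) : dot (a *: x) y = a * dot x y.
Proof. by rewrite dotC dotZr dotC. Qed.

Lemma dotNr m (x y : 'cV[R]_m) : dot x (- y) = - dot x y.
Proof. by rewrite -scaleN1r dotZr mulN1r. Qed.

Lemma dotNl m (x y : 'cV[R]_m) : dot (- x) y = - dot x y.
Proof. by rewrite dotC dotNr dotC. Qed.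

Lemma dot0l m (x : 'cV[R]_m) : dot 0 x = 0.
Proof. by rewrite -(scale0r 0) dotZl mul0r. Qed.

Lemma dot0r m (x : 'cV[R]_m) : dot x 0 = 0.
Proof. by rewrite dotC dot0l. Qed.

Lemma dot_sumr m (I : finType) (Q : pred I) (x : 'cV[R]_m) (y : I -> 'cV[R]_m) :
  dot x (\sum_(i | Q i) y i) = \sum_(i | Q i) dot x (y i).
Proof.
by elim/big_rec2: _ => [|i a b _ <-]; rewrite ?dot0r// dotDr.
Qed.

Lemma dot_suml m (I : finType) (Q : pred I) (x : 'cV[R]_m) (y : I -> 'cV[R]_m) :
  dot (\sum_(i | Q i) y i) x = \sum_(i | Q i) dot (y i) x.
Proof. by rewrite dotC dot_sumr; apply: eq_bigr => i _; rewrite dotC. Qed.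

Lemma dot_mull m p (A : 'M[R]_(m, p)) x y : dot (A *m x) y = dot x (A^T *m y).
Proof. by rewrite !dotE trmx_mul mulmxA. Qed.

Lemma dot_delta m (x : 'cV[R]_m) j : dot (delta_mx j 0) x = x j 0.
Proof.
rewrite /dot (bigD1 j)//= big1 => [|i ij]; first by rewrite !mxE !eqxx mul1r addr0.
by rewrite mxE (negPf ij) mul0r.
Qed.

(** Expands a quadratic form at a linear combination into basic inner products, so that [ring],
    [field] or [lra] can finish. *)
Definition bilinE := (@mulmxDr R, @mulmxN R,
  fun m n p a A B => esym (@scalemxAr R m n p a A B),
  dotDl, dotDr, dotNl, dotNr, dotZl, dotZr).

End Dot.

(** * Quadratic forms of symmetric positive definite matrices *)

Section PosDef.
Variables (R : realType) (m : nat) (W : 'M[R]_m).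
Hypothesis hW : sym_posdef W.

Lemma posdef_dotC x y : dot (W *m x) y = dot (W *m y) x.
Proof. by rewrite dot_mull (proj1 hW) dotC. Qed.

Lemma posdef_ge0 x : 0 <= dot (W *m x) x.
Proof.
have [->|x0] := eqVneq x 0; first by rewrite dot0r.
exact/ltW/(proj2 hW).
Qed.

Lemma posdef_unit : W \in unitmx.
Proof.
rewrite -row_free_unit; apply: inj_row_free => v vW.
have Wv : W *m v^T = 0 by rewrite -[W in LHS](proj1 hW) -trmx_mul vW trmx0.
have [->//|v0] := eqVneq v 0.
have := proj2 hW v^T; rewrite Wv dot0l ltxx.
suff -> : v^T != 0 by move=> /(_ isT).
by apply: contra v0 => /eqP h; rewrite -(trmxK v) h trmx0.
Qed.

Lemma posdef_cauchy_schwarz x y :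
  dot (W *m x) y ^+ 2 <= dot (W *m x) x * dot (W *m y) y.
Proof.
have [->|y0] := eqVneq y 0; first by rewrite !dot0r expr0n mulr0.
have yy := proj2 hW y y0.
(* This combination is chosen because its form factors as [c * (a * c - b ^+ 2)], in the notation
   set below. *)
have := posdef_ge0 (dot (W *m y) y *: x - dot (W *m x) y *: y).
rewrite !bilinE (posdef_dotC y x).
set a := dot (W *m x) x; set b := dot (W *m x) y; move: yy.
set c := dot (W *m y) y => c0.
rewrite [X in 0 <= X](_ : _ = c * (a * c - b ^+ 2)); last by ring.
by rewrite pmulr_rge0// subr_ge0.
Qed.

(** The coordinate [t j 0] is the inner product for [W] of [t] with [invmx W *m delta_mx j 0], so
    Cauchy-Schwarz applies. *)
Lemma posdef_coord_le (t : 'cV[R]_m) j :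
  t j 0 ^+ 2 <= dot (delta_mx j 0) (invmx W *m delta_mx j 0) * dot (W *m t) t.
Proof.
have := posdef_cauchy_schwarz (invmx W *m delta_mx j 0) t.
by rewrite mulKVmx ?posdef_unit// (dot_delta t).
Qed.

Lemma posdef_coord_bound :
  exists2 C : R, 0 < C & forall (t : 'cV[R]_m) j,
    `|t j 0| <= C * Num.sqrt (dot (W *m t) t).
Proof.
pose c j := dot (delta_mx j 0) (invmx W *m delta_mx j 0).
(* The sum dominates the constant of each coordinate; the leading 1 keeps it positive even for
   [m = 0], since it serves as a divisor later. *)
exists (1 + \sum_j Num.sqrt (c j)).
  by apply: ltr_pwDl => //; apply: sumr_ge0 => j _; apply: sqrtr_ge0.
move=> t j; rewrite -sqrtr_sqr.
apply: (le_trans (ler_wsqrtr (posdef_coord_le t j))).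
have c0 : 0 <= c j.
  by have := posdef_ge0 (invmx W *m delta_mx j 0); rewrite mulKVmx ?posdef_unit.
rewrite sqrtrM// ler_wpM2r ?sqrtr_ge0//.
rewrite (bigD1 j)//= addrCA lerDl addr_ge0//.
by apply: sumr_ge0 => i _; apply: sqrtr_ge0.
Qed.

End PosDef.

(** * Block decomposition and the weighted norm *)

Section Blocks.
Variables (R : realType) (n : nat) (N_ : 'I_n -> nat).
Variables (U : 'M[R]_(\sum_i N_ i)) (B : forall i, 'M[R]_(N_ i)) (w : 'I_n -> R).
Hypothesis hU : column_permutation_of_1 U.

Local Notation U_ := (submxrow U).

Lemma column_permutation_orthogonal : U^T *m U = 1%:M.
Proof.
have [s ->] := hU.
rewrite col_permE mul1mx.
by rewrite tr_perm_mx -perm_mxM mulVg perm_mx1.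
Qed.

Lemma submxrow_orthogonal i : (U_ i)^T *m U_ i = 1%:M.
Proof.
rewrite mul_submxrow tr_submxrow submxcol_mul column_permutation_orthogonal.
apply/matrixP => a b; rewrite !mxE.
by rewrite -val_eqE tagnat.eq_Rank eqxx val_eqE.
Qed.

Lemma submxrow_orthogonal_neq i j : i != j -> (U_ i)^T *m U_ j = 0.
Proof.
move=> ij; rewrite mul_submxrow tr_submxrow submxcol_mul.
rewrite column_permutation_orthogonal.
apply/matrixP => a b; rewrite !mxE.
by rewrite -val_eqE tagnat.eq_Rank (negPf ij).
Qed.

Lemma sum_blocks x : \sum_i U_ i *m block U i x = x.
Proof.
transitivity ((\sum_i U_ i *m (U_ i)^T) *m x).
  by rewrite mulmx_suml; apply: eq_bigr => i _; rewrite mulmxA.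
have -> : \sum_i U_ i *m (U_ i)^T = U *m U^T.
  rewrite -[in RHS](submxrowK U) tr_mxrow mul_mxrow_mxcol.
  by apply: eq_bigr.
by rewrite (mulmx1C column_permutation_orthogonal) mul1mx.
Qed.

Lemma block_restrict_blocks i x (S : {set 'I_n}) :
  block U i (restrict_blocks U x S) = (i \in S)%:R *: block U i x.
Proof.
rewrite /block mulmx_sumr big_mkcond (bigD1 i)//= [X in _ + X]big1 ?addr0.
  case: ifP => _; last by rewrite scale0r.
  by rewrite mulmxA submxrow_orthogonal mul1mx scale1r.
move=> j ji; case: ifP => // _.
by rewrite mulmxA submxrow_orthogonal_neq 1?eq_sym// mul0mx.
Qed.

Lemma dot_restrict_blocks g x (S : {set 'I_n}) :
  dot g (restrict_blocks U x S)
  = \sum_i (i \in S)%:R * dot g (U_ i *m block U i x).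
Proof.
rewrite dot_sumr big_mkcond; apply: eq_bigr => i _.
by case: ifP; rewrite ?mul1r ?mul0r.
Qed.

(** Gram matrix of the weighted norm: it makes the results on positive definite matrices available
    for [wnorm U B w]. *)
Definition wmatrix : 'M[R]_(\sum_i N_ i) :=
  \sum_i w i *: (U_ i *m B i *m (U_ i)^T).

Hypothesis hB : forall i, sym_posdef (B i).
Hypothesis hw : forall i, 0 < w i.

Lemma dot_wmatrix x y :
  dot (wmatrix *m x) y = \sum_i w i * dot (B i *m block U i x) (block U i y).
Proof.
rewrite mulmx_suml dot_suml; apply: eq_bigr => i _.
by rewrite -scalemxAl dotZl -!mulmxA dot_mull.
Qed.

Lemma wnorm_sqr_blocks x :
  wnorm U B w x ^+ 2 = \sum_i w i * dot (B i *m block U i x) (block U i x).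
Proof.
have E : \sum_i w i * bnorm (B i) (block U i x) ^+ 2
    = \sum_i w i * dot (B i *m block U i x) (block U i x).
  by apply: eq_bigr => i _; rewrite sqr_sqrtr// posdef_ge0.
rewrite /wnorm E sqr_sqrtr//; apply: sumr_ge0 => i _.
by rewrite mulr_ge0 ?(ltW (hw i))// posdef_ge0.
Qed.

Lemma wnorm_sqr x : wnorm U B w x ^+ 2 = dot (wmatrix *m x) x.
Proof. by rewrite wnorm_sqr_blocks dot_wmatrix. Qed.

Lemma wnorm_sqr_restrict_blocks x (S : {set 'I_n}) :
  wnorm U B w (restrict_blocks U x S) ^+ 2
  = \sum_i (i \in S)%:R * (w i * dot (B i *m block U i x) (block U i x)).
Proof.
rewrite wnorm_sqr_blocks; apply: eq_bigr => i _; rewrite block_restrict_blocks.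
by case: (i \in S); rewrite ?scale1r ?mul1r// scale0r dot0r mulr0 mul0r.
Qed.

Lemma wmatrix_posdef : sym_posdef wmatrix.
Proof.
split.
  rewrite linear_sum; apply: eq_bigr => i _.
  by rewrite linearZ/= !trmx_mul trmxK (proj1 (hB i)) mulmxA.
move=> x x0; rewrite dot_wmatrix lt_def; apply/andP; split; last first.
  by apply: sumr_ge0 => i _; rewrite mulr_ge0 ?(ltW (hw i))// posdef_ge0.
(* A vanishing sum of nonnegative terms kills every block of [x], and [x] is the sum of its
   blocks. *)
apply: contra x0; rewrite psumr_eq0 => [/allP h|i _]; last first.
  by rewrite mulr_ge0 ?(ltW (hw i))// posdef_ge0.
apply/eqP; rewrite -(sum_blocks x); apply: big1 => i _.
have [->|b0] := eqVneq (block U i x) 0; first by rewrite mulmx0.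
have := h i (mem_index_enum i).
by rewrite mulf_eq0 (gt_eqF (hw i)) (gt_eqF (proj2 (hB i) _ b0)).
Qed.

End Blocks.

(** * Subgradients and directional derivatives *)

Section Subgradients.
Variables (R : realType) (m : nat).
Implicit Types (f q : 'cV[R]_m -> R) (phi : 'cV[R]_m -> \bar R).
Implicit Types (x y z v g : 'cV[R]_m).

Lemma dot_gradient f x v : differentiable f x -> dot (gradient f x) v = 'D_v f x.
Proof.
move=> df; rewrite deriveE// {2}(matrix_sum_delta v) linear_sum.
apply: eq_bigr => j _; rewrite big_ord1 linearZ/= mxE deriveE//.
by rewrite mulrC.
Qed.

(** The derivative is also the right-hand limit of the difference quotient, so small positive [t]
    suffice; convexity arguments give bounds only for [t] between 0 and 1. *)
Lemma le_derive f x v c : differentiable f x ->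
  (forall t : R, 0 < t -> t <= 1 -> t * c <= f (x + t *: v) - f x) ->
  c <= 'D_v f x.
Proof.
move=> df h.
have dv : derivable f x v by exact: diff_derivable.
have {}dv := cvg_dnbhs_at_right dv.
apply: (cvgr_to_ge dv); near=> t.
have t0 : 0 < t by near: t; exact: nbhs_right_gt.
have t1 : t <= 1 by near: t; exact: nbhs_right_le.
rewrite /= -[_ *: _]/(_ * _) ler_pdivlMl//.
by rewrite (addrC _ x); exact: h.
Unshelve. all: by end_near. Qed.

Lemma derive_le f x v c : differentiable f x ->
  (forall t : R, 0 < t -> t <= 1 -> f (x + t *: v) - f x <= t * c) ->
  'D_v f x <= c.
Proof.
move=> df h.
have dv : derivable f x v by exact: diff_derivable.
have {}dv := cvg_dnbhs_at_right dv.
apply: (cvgr_to_le dv); near=> t.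
have t0 : 0 < t by near: t; exact: nbhs_right_gt.
have t1 : t <= 1 by near: t; exact: nbhs_right_le.
rewrite /= -[_ *: _]/(_ * _) ler_pdivrMl//.
by rewrite (addrC _ x); exact: h.
Unshelve. all: by end_near. Qed.

Lemma convex_functionE f : convex_function [set: 'cV[R]_m] f ->
  forall x y t, 0 <= t -> t <= 1 ->
  f (t *: x + (1 - t) *: y) <= t * f x + (1 - t) * f y.
Proof.
move=> cf x y t t0 t1.
have := cf (Itv01 t0 t1) x y (in_setT x) (in_setT y).
by [].
Qed.

Lemma gradient_subgradient f x : differentiable f x ->
  convex_function [set: 'cV[R]_m] f ->
  subgradient (fun x => (f x)%:E) x (gradient f x).
Proof.
move=> df cf y; rewrite -EFinD lee_fin addrC -lerBrDr dot_gradient//.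
apply: derive_le => // t t0 t1.
have := convex_functionE cf y x (ltW t0) t1.
have -> : t *: y + (1 - t) *: x = x + t *: (y - x).
  by rewrite scalerBl scalerBr scale1r; rewrite addrCA.
lra.
Qed.

Lemma convex_efun_fin phi x y a b t : avoids_ninfty phi -> convex_efun phi ->
  phi x = a%:E -> phi y = b%:E -> 0 <= t -> t <= 1 ->
  exists2 c, phi (t *: x + (1 - t) *: y) = c%:E & c <= t * a + (1 - t) * b.
Proof.
move=> an cv px py t0 t1; have := cv x y t t0 t1; rewrite px py.
have := an (t *: x + (1 - t) *: y).
by case: (phi _) => [c| |]//= _ ?; exists c.
Qed.

Lemma avoids_ninfty_fin phi x : avoids_ninfty phi -> edom phi x ->
  phi x = (fine (phi x))%:E.
Proof. by move=> /(_ x) + ; rewrite /edom/=; case: (phi x). Qed.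

(* The condition on [q] says that [dot g v] bounds from above the one-sided
   directional derivatives of [q] at [z]; it covers differentiable functions
   and quadratic forms alike. *)
Lemma minimizer_subgradient q phi z g : avoids_ninfty phi -> convex_efun phi ->
  edom phi z ->
  (forall v c, (forall t : R, 0 < t -> t <= 1 -> t * c <= q (z + t *: v) - q z) ->
     c <= dot g v) ->
  (forall y, (q z)%:E + phi z <= (q y)%:E + phi y)%E ->
  subgradient phi z (- g).
Proof.
move=> an cv dz hq hmin y.
have pz := avoids_ninfty_fin an dz; rewrite pz.
have := an y; case py : (phi y) => [b| |]// _; last by rewrite leey.
rewrite -EFinD lee_fin dotNl.
suff : fine (phi z) - b <= dot g (y - z) by lra.
apply: hq => t t0 t1.
have [c pc cle] := convex_efun_fin an cv py pz (ltW t0) t1.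
have -> : z + t *: (y - z) = t *: y + (1 - t) *: z.
  by rewrite scalerBl scalerBr scale1r addrCA.
have := hmin (t *: y + (1 - t) *: z); rewrite pz pc -!EFinD lee_fin.
lra.
Qed.

(** Dividing by [t] leaves [c <= L + t * C], where [t] may tend to 0. *)
Lemma le_slope (c L C : R) :
  (forall t : R, 0 < t -> t <= 1 -> t * c <= t * L + t ^+ 2 * C) -> c <= L.
Proof.
move=> h; apply/ler_addgt0Pr => e e0.
have C0 := normr_ge0 C.
have d0 : 0 < e + `|C| by rewrite ltr_wpDr.
(* This choice gives both [t <= 1] and [t] times the absolute value of [C] at most [e]. *)
pose t := e / (e + `|C|).
have t0 : 0 < t by rewrite divr_gt0.
have t1 : t <= 1 by rewrite ler_pdivrMr// mul1r lerDl.
have := h t t0 t1; rewrite expr2 -mulrA -mulrDr ler_pM2l// => /le_trans; apply.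
rewrite lerD2l (le_trans (ler_norm _))// normrM (gtr0_norm t0).
rewrite /t mulrAC ler_pdivrMr// ler_pM2l// lerDr ltW//.
Qed.

End Subgradients.

(** * Minimization of a quadratic plus a closed convex function *)

Section DotCvg.
Variables (R : realType) (m : nat) (T : Type) (F : set_system T).
Context {FF : Filter F}.

Lemma cvg_coord (u : T -> 'cV[R]_m) (z : 'cV[R]_m) j :
  u x @[x --> F] --> z -> u x j 0 @[x --> F] --> z j 0.
Proof.
move=> uz; apply: (cvg_comp u (fun A : 'cV[R]_m => A j 0) uz).
exact: (@coord_continuous R m 1 j 0).
Qed.

Lemma cvg_dot (u v : T -> 'cV[R]_m) (y z : 'cV[R]_m) :
  (forall j, u x j 0 @[x --> F] --> y j 0) ->
  (forall j, v x j 0 @[x --> F] --> z j 0) ->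
  dot (u x) (v x) @[x --> F] --> dot y z.
Proof.
move=> uy vz; apply: cvg_big => [|j _]; last exact: cvgM.
exact: add_continuous.
Qed.

End DotCvg.

Section Prox.
Variables (R : realType) (m : nat) (W : 'M[R]_m) (beta : R) (a x : 'cV[R]_m).
Hypotheses (hW : sym_posdef W) (hbeta : 0 < beta).
Implicit Types y z v : 'cV[R]_m.

(** With [a] the gradient of [f] at [x] and [W] the matrix of the weighted norm, this is the smooth
    part of the update model in the new point [y = x + h], without the constant [f x]. *)
Definition quad y : R :=
  dot a (y - x) + beta / 2 * dot (W *m (y - x)) (y - x).

(** Exact second-order Taylor expansion: [a + beta *: (W *m (y - x))] is the gradient of [quad] at
    [y]. *)
Lemma quadD y v : quad (y + v)
  = quad y + dot (a + beta *: (W *m (y - x))) v + beta / 2 * dot (W *m v) v.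
Proof.
rewrite /quad addrAC; move: (y - x) => e.
by rewrite !bilinE (posdef_dotC hW v e); field.
Qed.

(** The quadratic remainder vanishes in the limit of small [t]. This is the condition on [q] in
    [minimizer_subgradient]. *)
Lemma quad_slope z v c :
  (forall t : R, 0 < t -> t <= 1 -> t * c <= quad (z + t *: v) - quad z) ->
  c <= dot (a + beta *: (W *m (z - x))) v.
Proof.
move=> h; apply: (le_slope (C := beta / 2 * dot (W *m v) v)) => t t0 t1.
apply: le_trans (h t t0 t1) _; rewrite quadD !bilinE.
by rewrite le_eqVlt; apply/orP; left; apply/eqP; ring.
Qed.

Lemma quad_bounded_below b : exists c, forall y, c <= quad y + dot b y.
Proof.
(* Completing the square in [y - x]: the minimum is reached at [y - x = - (beta^-1 *: k)], and the
   witness below is the minimal value. *)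
pose k := invmx W *m (a + b).
exists (dot b x - (2 * beta)^-1 * dot (W *m k) k) => y.
have b0 : beta != 0 by rewrite gt_eqF.
have := posdef_ge0 hW ((y - x) + beta^-1 *: k).
rewrite -(pmulr_rge0 _ (divr_gt0 hbeta (ltr0n R 2))).
have -> : dot b y = dot b (y - x) + dot b x by rewrite -dotDr subrK.
rewrite /quad; move: (y - x) => e.
rewrite !bilinE (posdef_dotC hW e k).
have -> : dot (W *m k) e = dot a e + dot b e.
  by rewrite mulKVmx ?posdef_unit// dotDl.
set A := dot a e; set C := dot b e; set D := dot (W *m e) e.
set E := dot (W *m k) k; set G := dot b x => h.
rewrite -subr_ge0; apply: le_trans h _.
by rewrite le_eqVlt; apply/orP; left; apply/eqP; field.
Qed.

(** Strong convexity of the quadratic part, an equality at midpoints; the weight [1 - 2^-1] matches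
    the form of [convex_efun]. *)
Lemma quad_midpoint y z : quad (2^-1 *: y + (1 - 2^-1) *: z)
  = (quad y + quad z) / 2 - beta / 8 * dot (W *m (y - z)) (y - z).
Proof.
have -> : 2^-1 *: y + (1 - 2^-1) *: z = z + 2^-1 *: (y - z).
  by rewrite scalerBl scale1r scalerBr addrCA.
have -> : quad y = quad (z + (y - z)) by rewrite addrCA subrr addr0.
by rewrite !quadD !bilinE; field.
Qed.

Lemma cvg_quad (T : Type) (F : set_system T) {FF : Filter F}
    (u : T -> 'cV[R]_m) z :
  u k @[k --> F] --> z -> quad (u k) @[k --> F] --> quad z.
Proof.
move=> uz.
have ux j : (u k - x) j 0 @[k --> F] --> (z - x) j 0.
  by apply: cvg_coord; apply: cvgB => //; exact: cvg_cst.
apply: cvgD; first by apply: cvg_dot => // j; exact: cvg_cst.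
apply: cvgM; first exact: cvg_cst.
apply: cvg_dot => // j.
have E v : (W *m v) j 0 = dot (row j W)^T v.
  by rewrite mxE; apply: eq_bigr => l _; rewrite !mxE.
rewrite E; under eq_cvg do rewrite E.
by apply: cvg_dot => // l; exact: cvg_cst.
Qed.

Variable phi : 'cV[R]_m -> \bar R.
Hypotheses (phi_ninfty : avoids_ninfty phi) (phi_closed : closed_fun phi)
  (phi_convex : convex_efun phi).

(* A minimizing sequence is Cauchy by strong convexity of the quadratic part,
   and closedness of the epigraph makes its limit a minimizer. *)
Lemma prox_exists y1 g : edom phi y1 -> subgradient phi y1 g ->
  exists z, forall y, ((quad z)%:E + phi z <= (quad y)%:E + phi y)%E.
Proof.
move=> d1 sg.
pose r y := quad y + fine (phi y).
pose A := [set r y | y in edom phi].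
(* The subgradient [g] gives an affine minorant of [phi], which reduces boundedness below of [r] to
   that of [quad y + dot g y]. *)
have [c0 hc0] : exists c : R, forall y, c <= quad y + dot g y := quad_bounded_below g.
have infA : has_inf A.
  split; first by exists (r y1), y1.
  exists (c0 + fine (phi y1) - dot g y1) => _ [y dy <-].
  have := sg y; rewrite (avoids_ninfty_fin phi_ninfty d1).
  rewrite (avoids_ninfty_fin phi_ninfty dy) -EFinD lee_fin dotDr dotNr /r.
  have := hc0 y; lra.
pose mu := inf A.
have mule y : edom phi y -> mu <= r y.
  by move=> dy; apply: ge_inf; [exact: (proj2 infA)|exists y].
(* The value at the midpoint is at least [mu], so two nearly optimal points are close to each
   other. *)
have mid y z : edom phi y -> edom phi z ->
    beta / 8 * dot (W *m (y - z)) (y - z) <= (r y + r z) / 2 - mu.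
  move=> dy dz.
  have py := avoids_ninfty_fin phi_ninfty dy.
  have pz := avoids_ninfty_fin phi_ninfty dz.
  have h0 : 0 <= 2^-1 :> R by lra.
  have h1 : 2^-1 <= 1 :> R by lra.
  have [c pc cle] := convex_efun_fin phi_ninfty phi_convex py pz h0 h1.
  have : mu <= r (2^-1 *: y + (1 - 2^-1) *: z).
    by apply: mule; rewrite /edom/= pc ltry.
  rewrite {1}/r quad_midpoint pc/= /r; lra.
have /choice[u hu] : forall k : nat, exists y, edom phi y /\ r y < mu + k.+1%:R^-1.
  move=> k; have k0 : 0 < k.+1%:R^-1 :> R by rewrite invr_gt0 ltr0n.
  by have [_ [y dy <-] h] := inf_adherent k0 infA; exists y.
have [C C0 hC] := posdef_coord_bound hW.
have ucvg : cvg (u @ \oo).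
  apply/cauchy_cvgP/cauchy_exP => e e0.
  (* When both values are within [del] of [mu], [mid] bounds the norm of the difference by [e / C],
     and [hC] then bounds each coordinate by [e]. *)
  pose del := beta / 8 * (e / C) ^+ 2.
  have del0 : 0 < del by rewrite mulr_gt0 ?divr_gt0// exprn_gt0 ?divr_gt0.
  have := @cvg_harmonic R => /cvgrPdist_lt /(_ _ del0) [M _ hM].
  have small k : (M <= k)%N -> k.+1%:R^-1 < del.
    by move=> /hM; rewrite sub0r normrN ger0_norm// harmonic_ge0.
  exists (u M); exists M => // k Mk; split=> // i j; rewrite (ord1 j).
  rewrite -ball_normE/=.
  have := hC (u M - u k) i; rewrite !mxE => /le_lt_trans; apply.
  rewrite -ltr_pdivlMl// mulrC -[ltRHS]ger0_norm ?divr_ge0 ?ltW//.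
  rewrite -sqrtr_sqr ltr_sqrt ?exprn_gt0 ?divr_gt0//.
  rewrite -(ltr_pM2l (divr_gt0 hbeta (ltr0n R 8))).
  rewrite -[ltRHS]/del.
  have := mid _ _ (proj1 (hu M)) (proj1 (hu k)).
  have := proj2 (hu M); have := proj2 (hu k).
  have := small _ (leqnn M); have := small _ Mk.
  move: (_^-1 : R) (M.+1%:R^-1 : R) (_ * dot _ _) => e1 e2 D.
  lra.
pose z := lim (u @ \oo).
have uz : u @ \oo --> z by exact: ucvg.
have rmu : r (u k) @[k --> \oo] --> mu.
  apply: (@squeeze_cvgr _ _ _ _ (fun=> mu) (fun k => mu + k.+1%:R^-1)).
  - apply: nearW => k; apply/andP; split; first exact/mule/(proj1 (hu k)).
    exact/ltW/(proj2 (hu k)).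
  - exact: cvg_cst.
  - rewrite -[X in _ --> X]addr0; apply: cvgD; first exact: cvg_cst.
    exact: cvg_harmonic.
have epi : (phi z <= (mu - quad z)%:E)%E.
  (* The second component is [phi (u k)]; it converges because [r (u k)] tends to [mu] and [quad] is
     continuous. *)
  pose v k := (u k, r (u k) - quad (u k)).
  have vepi : \forall k \near \oo, (phi (v k).1 <= (v k).2%:E)%E.
    apply: nearW => k; rewrite /= /r addrAC subrr add0r.
    by rewrite -(avoids_ninfty_fin phi_ninfty (proj1 (hu k))).
  have vz : v @ \oo --> (z, mu - quad z).
    apply: (@cvg_pair _ _ _ \oo (nbhs z) (nbhs (mu - quad z)) _ _ _ u
      (fun k => r (u k) - quad (u k))); first exact: uz.
    by apply: cvgB => //; exact: cvg_quad.
  exact: (closed_cvg _ phi_closed vepi _ vz).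
exists z => y.
have [dy|] := boolP (phi y < +oo)%E; last first.
  by rewrite -leNgt leye_eq => /eqP ->; rewrite addey// leey.
apply: (@le_trans _ _ mu%:E).
  by apply: le_trans (leeD2l _ epi) _; rewrite -EFinD lee_fin addrCA subrr addr0.
by rewrite (avoids_ninfty_fin phi_ninfty dy) -EFinD lee_fin mule.
Qed.

End Prox.

(** * Random variables with finitely many values *)

Section FiniteRandomVariable.
Variables (R : realType) (d : measure_display) (T : measurableType d).
Variables (P : probability T R) (I : finType) (X : T -> I).
Hypothesis mX : forall a, measurable [set t | X t = a].

Definition pmf a : R := fine (P [set t | X t = a]).

Lemma pmf_ge0 a : 0 <= pmf a.
Proof. exact/fine_ge0/measure_ge0. Qed.

Lemma pmfE a : P [set t | X t = a] = (pmf a)%:E.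
Proof. by rewrite fineK// fin_num_measure. Qed.

Lemma finite_rv_measurable (Q : pred I) : measurable [set t | Q (X t)].
Proof.
have -> : [set t | Q (X t)] = \bigcup_(a in [set a | Q a]) [set t | X t = a].
  by apply/seteqP; split => [t Qt|t [a /= Qa ->]//]; exists (X t).
by apply: fin_bigcup_measurable => // a _; exact: mX.
Qed.

(** The variable [g (X t)] is the finite sum over [a] of [g a] times the indicator of [X t = a], and
    integration is linear. *)
Lemma expectation_pmf (g : I -> R) :
  ('E_P[fun t => g (X t)] = (\sum_a pmf a * g a)%:E)%E.
Proof.
rewrite unlock.
pose h a t : \bar R := ((g a)%:E * (\1_[set t | X t = a] t)%:E)%E.
have hint a : P.-integrable setT (h a).
  by apply: integrableZl => //; exact: integrable_indic.
transitivity (\int[P]_t (\sum_a h a t))%E.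
  apply: eq_integral => t _; rewrite (bigD1 (X t))//= big1.
    by rewrite /h indicE mem_set// mule1 adde0.
  by move=> a aX; rewrite /h indicE memNset ?mule0// => /esym/eqP; rewrite (negPf aX).
rewrite integral_sum// -sumEFin; apply: eq_bigr => a _.
rewrite integralZl//; last exact: integrable_indic.
by rewrite integral_indic// setIT mulrC EFinM; congr (_ * _)%E; exact: pmfE.
Qed.

Lemma prob_pmf (Q : pred I) : P [set t | Q (X t)] = (\sum_(a | Q a) pmf a)%:E.
Proof.
rewrite -(expectation_indic P (finite_rv_measurable Q)).
have -> : \1_[set t | Q (X t)] = (fun t => (Q (X t))%:R : R).
  apply/funext => t; rewrite indicE; congr (_%:R); congr nat_of_bool.
  by apply/idP/idP; rewrite inE.
rewrite (expectation_pmf (fun a => (Q a)%:R)) [in RHS]big_mkcond; congr (_%:E).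
by apply: eq_bigr => a _; case: (Q a); rewrite ?mulr1 ?mulr0.
Qed.

Lemma sum_pmf : \sum_a pmf a = 1.
Proof.
have := prob_pmf predT.
rewrite (_ : [set t | predT (X t)] = setT) ?probability_setT; last first.
  exact/seteqP.
by move=> [].
Qed.

Lemma sum_pmf_mulr (c : R) : \sum_a pmf a * c = c.
Proof. by rewrite -mulr_suml sum_pmf mul1r. Qed.

End FiniteRandomVariable.

(** * Averages over the blocks selected by a uniform sampling *)

Section UniformSampling.
Variables (R : realType) (d : measure_display) (T : measurableType d).
Variables (P : probability T R) (n : nat) (S : T -> {set 'I_n}).
Hypotheses (hS : random_subset S) (hproper : proper_sampling P S).
Hypothesis (hunif : uniform_sampling P S).

Local Notation p := (pmf P S).
Local Notation alpha := (sampling_rate P S).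

(** The expected size is the sum of the [n] membership probabilities, all equal by uniformity, so
    dividing by [n] leaves the one of [i]. The index [i] also ensures that [n] is nonzero. *)
Lemma sampling_rateE i : alpha = \sum_A p A * (i \in A)%:R.
Proof.
have marg j : \sum_A p A * (j \in A)%:R = fine (P [set t | j \in S t]).
  rewrite (prob_pmf P hS (fun A : {set 'I_n} => j \in A))/= [in RHS]big_mkcond.
  by apply: eq_bigr => A _; case: (j \in A); rewrite ?mulr1 ?mulr0.
rewrite /sampling_rate (expectation_pmf P hS (fun A => #|A|%:R))/=.
have -> : \sum_A p A * #|A|%:R = \sum_(j < n) \sum_A p A * (j \in A)%:R.
  rewrite exchange_big/=; apply: eq_bigr => A _.
  rewrite -mulr_sumr -sum1_card natr_sum big_mkcond; congr (_ * _).
  by apply: eq_bigr => j _; case: (j \in A).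
rewrite (eq_bigr (fun=> \sum_A p A * (i \in A)%:R)); last first.
  by move=> j _; rewrite !marg (hunif j i).
rewrite sumr_const card_ord -[X in X / _]mulr_natr mulfK//.
by rewrite pnatr_eq0 -lt0n (leq_ltn_trans _ (ltn_ord i)).
Qed.

(** Each block is selected with probability [alpha]. This averages both the strong convexity bound
    of [f] and the block values of [Omega]. *)
Lemma sum_pmf_blocks (c : 'I_n -> R) :
  \sum_A p A * (\sum_i (i \in A)%:R * c i) = alpha * \sum_i c i.
Proof.
rewrite mulr_sumr; under eq_bigr do rewrite mulr_sumr.
rewrite exchange_big/=; apply: eq_bigr => i _.
by rewrite (sampling_rateE i) mulr_suml; apply: eq_bigr => A _; rewrite mulrA.
Qed.

Lemma sampling_rate_gt0 (i : 'I_n) : 0 < alpha.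
Proof.
have := hproper i.
rewrite (prob_pmf P hS (fun A : {set 'I_n} => i \in A))/= big_mkcond lte_fin.
rewrite (sampling_rateE i) (eq_bigr (fun A => p A * (i \in A)%:R))//.
by move=> A _; case: (i \in A); rewrite ?mulr1 ?mulr0.
Qed.

Lemma sampling_rate_le1 (i : 'I_n) : alpha <= 1.
Proof.
rewrite (sampling_rateE i) -[leRHS](sum_pmf P hS); apply: ler_sum => A _.
by rewrite ler_piMr ?pmf_ge0// lern1 leq_b1.
Qed.

End UniformSampling.

(** * One step of the method *)

Section Gap.
Variables (R : realType) (m : nat) (f : 'cV[R]_m -> R).
Variables (Omega : 'cV[R]_m -> \bar R) (Fstar : R).
Hypothesis hOninfty : avoids_ninfty Omega.
Implicit Types x : 'cV[R]_m.

(** Because of [fine], this is the true gap only on the domain of the objective, which the iterates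
    never leave. *)
Definition gap x : R := fine (objective f Omega x) - Fstar.

Lemma edom_objective x : edom (objective f Omega) x <-> edom Omega x.
Proof.
rewrite /edom /objective/=; have := hOninfty x.
by case: (Omega x) => // r _; rewrite !ltry.
Qed.

Lemma gapE x : edom Omega x -> gap x = f x + fine (Omega x) - Fstar.
Proof.
by move=> dx; rewrite /gap /objective (avoids_ninfty_fin hOninfty dx).
Qed.

Lemma objectiveE x : edom (objective f Omega) x ->
  (objective f Omega x - Fstar%:E = (gap x)%:E)%E.
Proof.
move=> /edom_objective dx.
by rewrite gapE// /objective (avoids_ninfty_fin hOninfty dx).
Qed.

Lemma gap_ge0 x : min_value (objective f Omega) Fstar ->
  edom (objective f Omega) x -> 0 <= gap x.
Proof.
move=> hFstar dx; have := proj2 hFstar x.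
by rewrite -sube_ge0 ?objectiveE ?lee_fin.
Qed.

End Gap.

Section Step.
Variables (R : realType) (n : nat) (N_ : 'I_n -> nat).
Local Notation N := (\sum_i N_ i)%N.
Variables (U : 'M[R]_N) (B : forall i, 'M[R]_(N_ i)).
Variables (f : 'cV[R]_N -> R) (Omega : 'cV[R]_N -> \bar R) (Fstar : R).
Variables (d : measure_display) (T : measurableType d) (P : probability T R).
Variables (S : T -> {set 'I_n}) (beta : R) (w : 'I_n -> R) (mu_f mu_Omega : R).
Hypothesis hU : column_permutation_of_1 U.
Hypothesis hB : forall i, sym_posdef (B i).
Hypothesis hfdiff : forall x, differentiable f x.
Hypothesis hfconv : convex_function [set: 'cV[R]_N] f.
Hypothesis hOninfty : avoids_ninfty Omega.
Hypothesis hOclosed : closed_fun Omega.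
Hypothesis hOconv : convex_efun Omega.
Hypothesis hOsep : block_separable U Omega.
Hypothesis hFstar : min_value (objective f Omega) Fstar.
Hypothesis hS : random_subset S.
Hypothesis hproper : proper_sampling P S.
Hypothesis hunif : uniform_sampling P S.
Hypothesis hbeta : 0 < beta.
Hypothesis hw : forall i, 0 < w i.
Hypothesis hESO : ESO U B P f S beta w.
Hypothesis hmuf : convexity_parameter (wnorm U B w) (fun x => (f x)%:E) mu_f.
Hypothesis hmuO : convexity_parameter (wnorm U B w) Omega mu_Omega.
Hypothesis hmu : 0 < mu_f + mu_Omega.
Implicit Types x y z h : 'cV[R]_N.

Local Notation W := (wmatrix U B w).
Local Notation alpha := (sampling_rate P S).
Local Notation p := (pmf P S).
Local Notation upd := (update U B f Omega beta w).
Local Notation model x := (quad W beta (gradient f x) x).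
Local Notation omega x := (fine (Omega x)).
Local Notation gap := (gap f Omega Fstar).
Local Notation gamma := ((mu_f + mu_Omega) / (beta + mu_Omega)).

Let hW : sym_posdef W := wmatrix_posdef hU hB hw.

Lemma minimizer_edom x : objective f Omega x = Fstar%:E -> edom Omega x.
Proof.
by move=> e; apply/(edom_objective f hOninfty); rewrite /edom/= e ltry.
Qed.

(** First-order optimality for [f + Omega]. It supplies the affine minorant of [Omega] behind the
    existence of the update at every point. *)
Lemma minimizer_subgradient_Omega x : objective f Omega x = Fstar%:E ->
  subgradient Omega x (- gradient f x).
Proof.
move=> e; apply: (minimizer_subgradient (q := f)) => //.
- exact: minimizer_edom.
- by move=> v c h; rewrite dot_gradient//; exact: le_derive.
- by move=> y; have := proj2 hFstar y; rewrite -e.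
Qed.

Lemma update_minimizes_model x y :
  ((model x (x + upd x))%:E + Omega (x + upd x)%R
    <= (model x y)%:E + Omega y)%E.
Proof.
have [xs e] := proj1 hFstar.
have [z zmin] := prox_exists (gradient f x) x hW hbeta hOninfty hOclosed hOconv
  (minimizer_edom e) (minimizer_subgradient_Omega e).
have xK h : x + h - x = h by rewrite addrAC subrr add0r.
have HE h : ((f x + dot (gradient f x) h + beta / 2 * wnorm U B w h ^+ 2)%:E
    + Omega (x + h)%R = (f x)%:E + ((model x (x + h))%:E + Omega (x + h)%R))%E.
  by rewrite /quad xK wnorm_sqr// addeA -EFinD addrA.
(* The default value 0 of [argmin] is ruled out: [z - x] minimizes the model in [h], the change of
   variable being [y = x + h]. *)
rewrite /update /argmin; case: xgetP => [h _ /(_ (y - x))|].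
  by rewrite !HE leeD2lE// addrCA subrr addr0.
move=> /(_ (z - x)) []; move=> h /=.
by rewrite !HE leeD2lE// addrCA subrr addr0; exact: zmin.
Qed.

Lemma edom_update x : edom Omega x -> edom Omega (x + upd x).
Proof.
rewrite /edom/= => dx; have := update_minimizes_model x x.
rewrite (avoids_ninfty_fin hOninfty dx).
by case: (Omega (x + upd x)%R) => // r _; rewrite ltry.
Qed.

Lemma update_subgradient x : edom Omega x ->
  subgradient Omega (x + upd x)
    (- (gradient f x + beta *: (W *m (x + upd x - x)))).
Proof.
move=> dx; apply: (minimizer_subgradient (q := model x)) => //.
- exact: edom_update.
- by move=> v c; exact: quad_slope.
- exact: update_minimizes_model.
Qed.

(* Only the subgradient of [Omega] at [x + upd x] is available: the strong
   convexity inequality there, towards [x] and towards the minimizer, is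
   combined with weights [1 - gamma] and [gamma]; what remains is a multiple of
   the squared norm of [gamma (xs - x) - upd x]. *)
Lemma model_contraction x : mu_f <= beta -> edom Omega x ->
  f x + model x (x + upd x) + omega (x + upd x) - Fstar
  <= (1 - gamma) * gap x.
Proof.
move=> mub dx.
have [xs e] := proj1 hFstar.
have ds := minimizer_edom e.
have mO0 := proj1 hmuO; have mf0 := proj1 hmuf.
have bm0 : 0 < beta + mu_Omega by rewrite ltr_wpDr.
have g0 : 0 <= gamma by rewrite divr_ge0 ?ltW.
have g1 : 0 <= 1 - gamma by rewrite subr_ge0 ler_pdivrMr// mul1r lerD2r.
have muE : mu_f = gamma * (beta + mu_Omega) - mu_Omega.
  by rewrite divfK ?gt_eqF// addrK.
have eF : Fstar = f xs + omega xs.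
  by move: e; rewrite /objective (avoids_ninfty_fin hOninfty ds) => -[].
have dz := edom_update dx; have sz := update_subgradient dx.
have I1 := proj2 hmuO _ _ _ dz ds sz.
have I2 := proj2 hmuO _ _ _ dz dx sz.
have I3 := proj2 hmuf x xs _ (ltry _) (ltry _)
  (gradient_subgradient (hfdiff x) hfconv).
rewrite (avoids_ninfty_fin hOninfty ds) (avoids_ninfty_fin hOninfty dz) in I1.
rewrite (avoids_ninfty_fin hOninfty dx) (avoids_ninfty_fin hOninfty dz) in I2.
move: I1 I2 I3; rewrite gapE// eF -!EFinD !lee_fin !(wnorm_sqr U hB hw).
rewrite /quad; set g := gamma in g0 g1 muE *; set h := upd x; set s := xs - x.
have -> : xs - (x + h) = s - h by rewrite opprD addrA.
have -> : x - (x + h) = - h by rewrite opprD addrA subrr add0r.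
have -> : x + h - x = h by rewrite addrAC subrr add0r.
have I4 := posdef_ge0 hW (g *: s - h).
clearbody s h; move: I4; rewrite !bilinE (posdef_dotC hW s h).
set as_ := dot (gradient f x) s; set ah := dot (gradient f x) h.
set Qs := dot (W *m s) s; set Qh := dot (W *m h) h; set Bsh := dot (W *m h) s.
move: (fine _) (fine _) (fine _) (f x) (f xs) => os ox oz fx fs.
clearbody g as_ ah Qs Qh Bsh => I4 I1 I2 I3.
(* With [mu_f] written through [g], the claim is the sum of [J1], [J2], [J3] and half of [J4]. *)
have J1 := ler_wpM2l g0 I1.
have J2 := ler_wpM2l g1 I2.
have J3 := ler_wpM2l g0 I3.
have J4 := mulr_ge0 (ltW bm0) I4.
rewrite muE in J3.
lra.
Qed.

Lemma ESO_pmf x h :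
  \sum_A p A * f (x + restrict_blocks U h A)
  <= f x + alpha * (dot (gradient f x) h + beta / 2 * wnorm U B w h ^+ 2).
Proof.
have := hESO x h.
by rewrite (expectation_pmf P hS (fun A => f (x + restrict_blocks U h A))).
Qed.

(** The average of [f] over the restrictions of [h] lies above the averaged strong convexity bound
    at 0 and below the ESO bound. These differ only in [mu_f] against [beta], multiplied by a
    positive squared norm. *)
Lemma mu_f_le_beta h (i : 'I_n) : h != 0 -> mu_f <= beta.
Proof.
move=> h0; have up := ESO_pmf 0 h.
have a0 : 0 < alpha := sampling_rate_gt0 hS hproper hunif i.
have Q0 : 0 < wnorm U B w h ^+ 2 by rewrite (wnorm_sqr U hB hw) (proj2 hW).
(* Share of block [i] in the strong convexity bound; the bound for the restriction to [A] adds these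
   shares over [A]. *)
pose c i := dot (gradient f 0) (submxrow U i *m block U i h)
  + mu_f / 2 * (w i * dot (B i *m block U i h) (block U i h)).
have cE : \sum_j c j = dot (gradient f 0) h + mu_f / 2 * wnorm U B w h ^+ 2.
  rewrite big_split/= -mulr_sumr (wnorm_sqr_blocks U hB hw); congr (_ + _).
  by rewrite -dot_sumr sum_blocks.
have : f 0 + alpha * \sum_j c j <= \sum_A p A * f (0 + restrict_blocks U h A).
  rewrite -(sum_pmf_blocks hS hunif) -[f 0](sum_pmf_mulr P hS).
  rewrite -big_split/=; apply: ler_sum => A _; rewrite -mulrDr.
  apply: ler_wpM2l; first exact: pmf_ge0.
  have := proj2 hmuf 0 (0 + restrict_blocks U h A) _ (ltry _) (ltry _)
    (gradient_subgradient (hfdiff 0) hfconv).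
  rewrite subr0 add0r -EFinD lee_fin dot_restrict_blocks.
  rewrite (wnorm_sqr_restrict_blocks hU hB hw) mulr_sumr -big_split/=.
  apply: le_trans; rewrite lerD2l; apply: ler_sum => j _.
  by rewrite mulrDr mulrCA.
rewrite cE => /le_trans/(_ up); rewrite lerD2l ler_pM2l// lerD2l.
by rewrite ler_pM2r// ler_pM2r// invr_gt0.
Qed.

(** Each block of the partially updated point comes from [x + h] or from [x], so [Omega] stays
    finite there and is affine in the membership indicators, ready for averaging. *)
Lemma Omega_restrict_blocks x h : edom Omega x -> edom Omega (x + h) ->
  exists c0 c1 : 'I_n -> R, [/\ Omega x = (\sum_i c0 i)%:E,
    Omega (x + h) = (\sum_i c1 i)%:E &
    forall A : {set 'I_n}, Omega (x + restrict_blocks U h A)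
      = (\sum_i (c0 i + (i \in A)%:R * (c1 i - c0 i)))%:E].
Proof.
have [Om_ [hOm OmE]] := hOsep.
have fin y i : edom Omega y ->
    Om_ i (block U i y) = (fine (Om_ i (block U i y)))%:E.
  rewrite /edom/= OmE => dy; have [an _ _] := hOm i.
  have := an (block U i y); case e : (Om_ i (block U i y)) => [r| |]// _.
  (* No term is [-oo], so a single [+oo] would make the whole sum infinite. *)
  suff dy' : (\sum_(i < n) Om_ i (block U i y) = +oo)%E by rewrite dy' ltxx in dy.
  apply/esum_eqyP => [j _|]; last by exists i; rewrite mem_index_enum.
  by have [+ _ _] := hOm j; apply.
move=> dx dz.
exists (fun i => fine (Om_ i (block U i x))).
exists (fun i => fine (Om_ i (block U i (x + h)))).
rewrite -!sumEFin; split=> [| |A].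
- by rewrite OmE; apply: eq_bigr => i _; exact: fin.
- by rewrite OmE; apply: eq_bigr => i _; exact: fin.
rewrite OmE -sumEFin; apply: eq_bigr => i _.
rewrite {1}/block mulmxDr -!/(block U i _) block_restrict_blocks//.
case: (i \in A).
  rewrite scale1r mul1r addrCA subrr addr0 -fin//.
  by rewrite /block mulmxDr.
by rewrite scale0r mul0r !addr0 -fin.
Qed.

Lemma edom_restrict_blocks x h A : edom Omega x -> edom Omega (x + h) ->
  edom Omega (x + restrict_blocks U h A).
Proof.
move=> dx dz; have [c0 [c1 [_ _ OA]]] := Omega_restrict_blocks dx dz.
by rewrite /edom/= OA ltry.
Qed.

Lemma sum_pmf_Omega x h : edom Omega x -> edom Omega (x + h) ->
  \sum_A p A * omega (x + restrict_blocks U h A)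
  = omega x + alpha * (omega (x + h) - omega x).
Proof.
move=> dx dz; have [c0 [c1 [-> -> OA]]] := Omega_restrict_blocks dx dz.
rewrite -sumrB -(sum_pmf_blocks hS hunif)/=
  -[X in X + _](sum_pmf_mulr P hS).
rewrite -big_split/=; apply: eq_bigr => A _.
by rewrite OA/= -mulrDr -big_split.
Qed.

Lemma edom_step x A : edom (objective f Omega) x ->
  edom (objective f Omega) (x + restrict_blocks U (upd x) A).
Proof.
move=> /(edom_objective f hOninfty) dx; apply/(edom_objective f hOninfty).
by apply: edom_restrict_blocks => //; exact: edom_update.
Qed.

Lemma expected_decrease x : mu_f <= beta -> 0 <= alpha ->
  edom (objective f Omega) x ->
  \sum_A p A * gap (x + restrict_blocks U (upd x) A)
  <= (1 - alpha * gamma) * gap x.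
Proof.
move=> mub a0 /(edom_objective f hOninfty) dx; have dz := edom_update dx.
rewrite (eq_bigr (fun A => p A * f (x + restrict_blocks U (upd x) A)
    + p A * omega (x + restrict_blocks U (upd x) A) - p A * Fstar)); last first.
  by move=> A _; rewrite gapE ?mulrBr ?mulrDr//; exact: edom_restrict_blocks.
rewrite sumrB big_split/= (sum_pmf_mulr P hS) sum_pmf_Omega//.
have := ESO_pmf x (upd x); rewrite (wnorm_sqr U hB hw).
have := ler_wpM2l a0 (model_contraction mub dx).
rewrite gapE// /quad.
have -> : x + upd x - x = upd x by rewrite addrAC subrr add0r.
lra.
Qed.

End Step.

(** * Iteration over independent samples *)

Lemma big_tuple_cons (V : nmodType) (I : finType) (K : nat)
    (g : K.+1.-tuple I -> V) :
  \sum_(s : K.+1.-tuple I) g s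
  = \sum_a \sum_(s : K.-tuple I) g [tuple of a :: s].
Proof.
rewrite pair_big/= (reindex (fun v : I * K.-tuple I => [tuple of v.1 :: v.2]))//.
exists (fun s => (thead s, [tuple of behead s])).
- by move=> [a s] _ /=; congr pair; apply/val_inj.
- by move=> s _; rewrite [RHS]tuple_eta.
Qed.

Section ExpectedIteration.
Variables (R : realType) (I : finType) (E : Type) (step : E -> I -> E).
Variables (D : set E) (V : E -> R) (p : I -> R) (q : R).
Hypotheses (p_ge0 : forall a, 0 <= p a) (q_ge0 : 0 <= q).
Hypothesis step_dom : forall x a, D x -> D (step x a).
Hypothesis step_decr : forall x, D x -> \sum_a p a * V (step x a) <= q * V x.

Lemma foldl_dom x s : D x -> D (foldl step x s).
Proof. by elim: s x => //= a s IHs x Dx; apply/IHs/step_dom. Qed.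

(** The left side is the expected value of [V] after [K] independent draws, as a sum over all
    sequences. Splitting off the first draw, the induction hypothesis starts from [step x a], and
    one more factor [q] comes from averaging over [a]. *)
Lemma sum_tuple_foldl_le K x : D x ->
  \sum_(s : K.-tuple I) (\prod_(a <- s) p a) * V (foldl step x s)
  <= q ^+ K * V x.
Proof.
elim: K x => [|K IHK] x Dx.
  rewrite (big_pred1 [tuple]) => [|s]; last by rewrite (tuple0 s); apply/esym/eqP.
  by rewrite big_nil.
rewrite big_tuple_cons exprSr -mulrA.
apply: le_trans (ler_wpM2l (exprn_ge0 K q_ge0) (step_decr Dx)).
rewrite mulr_sumr; apply: ler_sum => a _ /=; rewrite mulrCA.
under eq_bigr do rewrite big_cons -mulrA.
by rewrite -mulr_sumr; apply: ler_wpM2l => //; exact/IHK/step_dom.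
Qed.

End ExpectedIteration.

Section IndependentSets.
Variables (R : realType) (n : nat) (d : measure_display) (T : measurableType d).
Variables (P : probability T R) (S : nat -> T -> {set 'I_n}).
Variable p : {set 'I_n} -> R.
Hypotheses (hS : forall k, random_subset (S k))
  (hlaw : forall k A, P [set t | S k t = A] = (p A)%:E)
  (hindep : mutually_independent P S).

(** Bundled in a tuple, the first [K] samples form a single random variable with finitely many
    values. *)
Definition trajectory K t : K.-tuple {set 'I_n} :=
  [tuple of mkseq (fun k => S k t) K].

Lemma trajectory_eq K (s : K.-tuple {set 'I_n}) t :
  trajectory K t = s <->
  forall k, k \in iota 0 K -> S k t \in finset.set1 (nth finset.set0 s k).
Proof.
split=> [<- k|h].
  by rewrite mem_iota add0n /= => kK; rewrite inE nth_mkseq.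
apply/val_inj/(@eq_from_nth _ finset.set0); first by rewrite size_mkseq size_tuple.
move=> k; rewrite size_mkseq => kK; rewrite nth_mkseq//.
by apply/set1P/h; rewrite mem_iota.
Qed.

Lemma trajectory_measurable K (s : K.-tuple {set 'I_n}) :
  measurable [set t | trajectory K t = s].
Proof.
have -> : [set t | trajectory K t = s]
    = \bigcap_(k in `I_K) [set t | S k t = nth finset.set0 s k].
  apply/seteqP; split => t /=.
    by move=> /trajectory_eq h k kK; apply/set1P/h; rewrite mem_iota.
  by move=> h; apply/trajectory_eq => k; rewrite mem_iota => /h/= ->; rewrite inE.
by apply: fin_bigcap_measurable => // k _; exact: hS.
Qed.

Lemma pmf_trajectory K (s : K.-tuple {set 'I_n}) :
  pmf P (trajectory K) s = \prod_(A <- s) p A.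
Proof.
rewrite /pmf.
have -> : [set t | trajectory K t = s] = [set t | forall k, k \in iota 0 K ->
    S k t \in finset.set1 (nth finset.set0 s k)].
  by apply/seteqP; split => t /trajectory_eq.
rewrite (hindep (fun k => finset.set1 (nth finset.set0 s k)) (iota_uniq 0 K)).
rewrite (eq_bigr (fun k => (p (nth finset.set0 s k))%:E)); last first.
  move=> k _; rewrite -(hlaw k); congr (P _).
  by apply/seteqP; split=> t /set1P.
rewrite prodEFin/= (big_nth finset.set0) size_tuple.
by rewrite /index_iota subn0.
Qed.

Variables (E : Type) (step : E -> {set 'I_n} -> E) (D : set E) (V : E -> R).
Variable (q : R).
Hypotheses (q_ge0 : 0 <= q) (V_ge0 : forall x, D x -> 0 <= V x).
Hypothesis step_dom : forall x A, D x -> D (step x A).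
Hypothesis step_decr : forall x, D x -> \sum_A p A * V (step x A) <= q * V x.

(** Markov's inequality on the finite space of sequences: [eps] times the failure probability is at
    most the expected value of [V], hence at most [eps * rho]. *)
Lemma iteration_markov K x (eps rho : R) : D x -> 0 < eps ->
  q ^+ K * V x <= eps * rho ->
  ((1 - rho)%:E <=
    P [set t | (V (foldl step x (mkseq (fun k => S k t) K)) <= eps)%R])%E.
Proof.
move=> Dx e0 hq.
have p_ge0 A : 0 <= p A by rewrite -lee_fin -(hlaw 0).
pose Q (s : K.-tuple {set 'I_n}) := V (foldl step x s) <= eps.
have mZ := @trajectory_measurable K.
rewrite -[[set t | _]]/[set t | Q (trajectory K t)] (prob_pmf P mZ) lee_fin.
have := sum_pmf P mZ; rewrite (bigID Q)/=.
suff : \sum_(s | ~~ Q s) pmf P (trajectory K) s <= rho by lra.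
rewrite -(ler_pM2l e0); apply: le_trans hq.
apply: le_trans (sum_tuple_foldl_le p_ge0 q_ge0 step_dom step_decr K Dx).
(* The successful sequences contribute a nonnegative amount and are dropped; on the others [V]
   exceeds [eps]. *)
rewrite mulr_sumr [leRHS](bigID Q)/=; apply: ler_wpDl.
  apply: sumr_ge0 => s _; rewrite mulr_ge0 ?prodr_ge0//.
  by apply: V_ge0; exact: foldl_dom.
apply: ler_sum => s; rewrite /Q -ltNge => /ltW Vs.
by rewrite pmf_trajectory mulrC ler_wpM2l// prodr_ge0.
Qed.

End IndependentSets.

(** From [1 - c <= expR (- c)], the power is at most [expR (- (c * K))], and the bound on [K] makes
    this at most [e / V0]. *)
Lemma geometric_le (R : realType) (c V0 e : R) (K : nat) : 0 < c -> c <= 1 ->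
  0 < V0 -> 0 < e -> c^-1 * ln (V0 / e) <= K%:R -> (1 - c) ^+ K * V0 <= e.
Proof.
move=> c0 c1 V0_gt0 e0 hK.
have c1' : 0 <= 1 - c by rewrite subr_ge0.
have qe : 1 - c <= expR (- c) by exact: expR_ge1Dx.
rewrite -ler_pdivlMr//; apply: (le_trans (lerXn2r K c1' (expR_ge0 _) qe)).
rewrite -expRM_natl -[leRHS]lnK ?posrE ?divr_gt0// ler_expR.
rewrite -[e / V0]invrK invf_div lnV ?posrE ?divr_gt0// mulrN lerN2.
by rewrite -ler_pdivrMr// mulrC.
Qed.

(** * Both methods as iterated maps, and the high-probability bound *)

Section Algorithms.
Variables (R : realType) (n : nat) (N_ : 'I_n -> nat).
Local Notation N := (\sum_i N_ i)%N.
Variables (U : 'M[R]_N) (B : forall i, 'M[R]_(N_ i)).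
Variables (f : 'cV[R]_N -> R) (Omega : 'cV[R]_N -> \bar R).
Variables (beta : R) (w : 'I_n -> R) (x0 : 'cV[R]_N).

Definition PCDM1_step x A := x + restrict_blocks U (update U B f Omega beta w x) A.

Definition PCDM2_step x A := let y := PCDM1_step x A in
  if (objective f Omega y <= objective f Omega x)%E then y else x.

Lemma PCDM1_foldl (S : nat -> {set 'I_n}) K :
  PCDM1 U B f Omega beta w x0 S K = foldl PCDM1_step x0 (mkseq S K).
Proof. by elim: K => // K IHK; rewrite mkseqS foldl_rcons -IHK. Qed.

Lemma PCDM2_foldl (S : nat -> {set 'I_n}) K :
  PCDM2 U B f Omega beta w x0 S K = foldl PCDM2_step x0 (mkseq S K).
Proof. by elim: K => // K IHK; rewrite mkseqS foldl_rcons -IHK. Qed.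

(** A rejected candidate has a larger objective than [x], so for every sample PCDM2 does at least as
    well as PCDM1 from the same point, and inherits its expected decrease. *)
Lemma PCDM2_step_gap Fstar x A : avoids_ninfty Omega ->
  edom (objective f Omega) x -> edom (objective f Omega) (PCDM1_step x A) ->
  gap f Omega Fstar (PCDM2_step x A) <= gap f Omega Fstar (PCDM1_step x A).
Proof.
move=> On dx dy; rewrite /PCDM2_step/=; case: ifPn => //; rewrite -ltNge => xy.
rewrite -lee_fin -!objectiveE// leeD2r//; exact: ltW.
Qed.

End Algorithms.

Theorem theorem20 (R : realType)
  (n : nat) (N_ : 'I_n -> nat) (hN : forall i, (0 < N_ i)%N)
  (U : 'M[R]_(\sum_i N_ i)) (hU : column_permutation_of_1 U)
  (B : forall i, 'M[R]_(N_ i)) (hB : forall i, sym_posdef (B i))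
  (f : 'cV[R]_(\sum_i N_ i) -> R)
  (hfdiff : forall x, differentiable f x)
  (hfconv : convex_function [set: 'cV[R]_(\sum_i N_ i)] f)
  (hflip : block_lipschitz_gradient U B f)
  (Omega : 'cV[R]_(\sum_i N_ i) -> \bar R)
  (hOproper : proper_fun Omega) (hOclosed : closed_fun Omega)
  (hOconv : convex_efun Omega) (hOsep : block_separable U Omega)
  (Fstar : R) (hFstar : min_value (objective f Omega) Fstar)
  (d' : measure_display) (T' : measurableType d') (P' : probability T' R)
  (Shat : T' -> {set 'I_n}) (hShat : random_subset Shat)
  (hproper : proper_sampling P' Shat) (hunif : uniform_sampling P' Shat)
  (beta : R) (hbeta : 0 < beta) (w : 'I_n -> R) (hw : forall i, 0 < w i)
  (hESO : ESO U B P' f Shat beta w)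
  (mu_f mu_Omega : R)
  (hmuf : convexity_parameter (wnorm U B w) (fun x => (f x)%:E) mu_f)
  (hmuO : convexity_parameter (wnorm U B w) Omega mu_Omega)
  (hmu : 0 < mu_f + mu_Omega)
  (x0 : 'cV[R]_(\sum_i N_ i)) (hx0 : edom (objective f Omega) x0)
  (rho : R) (hrho0 : 0 < rho) (hrho1 : rho < 1)
  (eps : R) (heps0 : 0 < eps)
  (heps1 : (eps%:E < objective f Omega x0 - Fstar%:E)%E)
  (K : nat)
  (hK : (sampling_rate P' Shat)^-1 * ((beta + mu_Omega) / (mu_f + mu_Omega))
        * ln ((fine (objective f Omega x0) - Fstar) / (eps * rho)) <= K%:R)
  (d : measure_display) (T : measurableType d) (P : probability T R)
  (S : nat -> T -> {set 'I_n}) (hS : forall k, random_subset (S k))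
  (hlaw : forall k, same_law P (S k) P' Shat)
  (hindep : mutually_independent P S) :
  ((1 - rho)%:E <=
     P [set t | objective f Omega
                  (PCDM1 U B f Omega beta w x0 (fun k => S k t) K)
                - Fstar%:E <= eps%:E])%E
  /\
  ((1 - rho)%:E <=
     P [set t | objective f Omega
                  (PCDM2 U B f Omega beta w x0 (fun k => S k t) K)
                - Fstar%:E <= eps%:E])%E.
Proof.
have [On _] := hOproper.
have [xs e] := proj1 hFstar.
pose D := edom (objective f Omega); pose V := gap f Omega Fstar.
have V0 : eps < V x0 by move: heps1; rewrite objectiveE// lte_fin.
(* The initial gap exceeds [eps > 0], so [x0] is not the minimizer [xs]. This provides a nonzero
   direction and excludes [n = 0]. *)
have h0 : x0 - xs != 0.
  apply/eqP => /subr0_eq x0E; move: V0.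
  by rewrite x0E /V /gap e/= subrr ltNge (ltW heps0).
have [i _] : exists i : 'I_n, true.
  have [i _|no] := pickP (@predT 'I_n); first by exists i.
  move: h0; rewrite -(sum_blocks hU (x0 - xs)).
  by case/eqP; apply: big1 => i; have := no i.
set alpha := sampling_rate P' Shat in hK.
have a0 : 0 < alpha by exact: sampling_rate_gt0 hShat hproper hunif i.
have a1 : alpha <= 1 by exact: sampling_rate_le1 hShat hunif i.
have mub : mu_f <= beta.
  exact: (mu_f_le_beta hU hB hfdiff hfconv hShat hproper hunif hw hESO hmuf i h0).
have mO0 := proj1 hmuO.
have bm0 : 0 < beta + mu_Omega by rewrite ltr_wpDr.
pose gam := (mu_f + mu_Omega) / (beta + mu_Omega).
have g0 : 0 < gam by rewrite divr_gt0.
have g1 : gam <= 1 by rewrite ler_pdivrMr// mul1r lerD2r.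
have c0 : 0 < alpha * gam by rewrite mulr_gt0.
have c1 : alpha * gam <= 1 by rewrite mulr_ile1 // ltW.
have q0 : 0 <= 1 - alpha * gam by rewrite subr_ge0.
(* The bound on [K] is the condition of [geometric_le] for the rate [alpha * gam] and the target
   [eps * rho], whose factor [rho] is consumed by Markov's inequality. *)
have rate : (1 - alpha * gam) ^+ K * V x0 <= eps * rho.
  have Vp := lt_trans heps0 V0.
  apply: geometric_le => //; first by rewrite mulr_gt0.
  by rewrite invfM (invf_div (mu_f + mu_Omega)).
have Vge0 x : D x -> 0 <= V x by exact: gap_ge0.
pose s1 := PCDM1_step U B f Omega beta w; pose s2 := PCDM2_step U B f Omega beta w.
have dom1 x A : D x -> D (s1 x A).
  exact: (edom_step hU hB hfdiff On hOclosed hOconv hOsep hFstar hbeta hw A).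
have dom2 x A : D x -> D (s2 x A).
  by move=> Dx; rewrite /s2 /PCDM2_step/=; case: ifP => // _; exact: dom1.
have decr1 x : D x ->
    \sum_A pmf P' Shat A * V (s1 x A) <= (1 - alpha * gam) * V x.
  by move=> Dx; exact: (expected_decrease hU hB hfdiff hfconv On hOclosed hOconv
    hOsep hFstar hShat hunif hbeta hw hESO hmuf hmuO hmu mub (ltW a0)).
have decr2 x : D x ->
    \sum_A pmf P' Shat A * V (s2 x A) <= (1 - alpha * gam) * V x.
  move=> Dx; apply: le_trans (decr1 x Dx); apply: ler_sum => A _.
  apply: ler_wpM2l; first exact: pmf_ge0.
  by apply: PCDM2_step_gap => //; exact: dom1.
have law k A : P [set t | S k t = A] = (pmf P' Shat A)%:E.
  by rewrite hlaw pmfE.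
(* All iterates stay in the domain, so the extended-real event coincides with the event on the real
   gap. *)
have gapE s x : D x -> (forall y A, D y -> D (s y A)) ->
    [set t | (objective f Omega (foldl s x (mkseq (fun k => S k t) K)) - Fstar%:E
      <= eps%:E)%E]
    = [set t | V (foldl s x (mkseq (fun k => S k t) K)) <= eps].
  move=> Dx Ds; apply/seteqP.
  by split=> t /=; rewrite objectiveE ?lee_fin//; exact: (foldl_dom Ds).
split.
- under eq_set do rewrite PCDM1_foldl.
  rewrite gapE//; exact: (iteration_markov hS law hindep q0 Vge0 dom1 decr1).
- under eq_set do rewrite PCDM2_foldl.
  rewrite gapE//; exact: (iteration_markov hS law hindep q0 Vge0 dom2 decr2).
Qed.
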